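(* Let $V_1,\dots,V_{11}$ be the irreducible complex representations of the symmetric group $S_6$, numbered by the character table given in the context. The tensor products $V_1\otimes V_i$, $V_2\otimes V_i$ and $V_3\otimes V_i$ ($1\le i\le 11$) decompose as follows: \begin{align*} &V_1 \otimes V_j \cong V_j \otimes V_1 \cong V_j\quad\text{for all } j\in \{1,2,\dots,11\},\\ &V_2\otimes V_i\cong V_i\otimes V_2\cong V_{i-1}\quad\text{for } i\in\{2,4,6,8,10\},\\ &V_2\otimes V_i\cong V_i\otimes V_2\cong V_{i+1}\quad\text{for } i\in\{3,5,7,9\},\\ &V_2\otimes V_{11}\cong V_{11}\otimes V_2\cong V_{11},\\ &V_3\otimes V_3\cong V_1\oplus V_3\oplus V_5\oplus V_7,\\ &V_3\otimes V_4\cong V_4\otimes V_3\cong V_2\oplus V_4\oplus V_6\oplus V_8,\\ &V_3\otimes V_5\cong V_5\otimes V_3\cong V_3\oplus V_5\oplus V_7\oplus V_9\oplus V_{11},\\ &V_3\otimes V_6\cong V_6\otimes V_3\cong V_4\oplus V_6\oplus V_8\oplus V_{10}\oplus V_{11},\\ &V_3\otimes V_7\cong V_7\otimes V_3\cong V_3\oplus V_5\oplus V_7\oplus V_8\oplus V_{11},\\ &V_3\otimes V_8\cong V_8\otimes V_3\cong V_4\oplus V_6\oplus V_7\oplus V_8\oplus V_{11},\\ &V_3\otimes V_9\cong V_9\otimes V_3\cong V_5\oplus V_{11},\\ &V_3\otimes V_{10}\cong V_{10}\otimes V_3\cong V_6\oplus V_{11},\\ &V_3\otimes V_{11}\cong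 V_{11}\otimes V_3\cong V_5\oplus V_6\oplus V_7\oplus V_8\oplus V_9\oplus V_{10}\oplus 2V_{11}. \end{align*}
   Context: All representations are finite-dimensional over $\mathbb{C}$, and $mV$ denotes the direct sum of $m$ copies of $V$. The irreducible complex representation $V_i$ of $S_6$ is the one with character $\chi_i$ in the following table, where the columns are the conjugacy classes of $g_1,\dots,g_{11}$ with the given cycle types and sizes. $$\begin{array}{c|ccccccccccc} & g_1&g_2&g_3&g_4&g_5&g_6&g_7&g_8&g_9&g_{10}&g_{11}\\ \text{cycle type} & 1^6 & 2\,1^4 & 3\,2\,1 & 2^3 & 4\,1^2 & 6 & 2^2 1^2 & 3\,1^3 & 5\,1 & 4\,2 & 3^2\\ \text{size} & 1&15&120&15&90&120&45&40&144&90&40\\ \hline \chi_1&1&1&1&1&1&1&1&1&1&1&1\\ \chi_2&1&-1&-1&-1&-1&-1&1&1&1&1&1\\ \chi_3&5&3&0&-1&1&-1&1&2&0&-1&-1\\ \chi_4&5&-3&0&1&-1&1&1&2&0&-1&-1\\ \chi_5&9&3&0&3&-1&0&1&0&-1&1&0\\ \chi_6&9&-3&0&-3&1&0&1&0&-1&1&0\\ \chi_7&10&2&-1&-2&0&1&-2&1&0&0&1\\ \chi_8&10&-2&1&2&0&-1&-2&1&0&0&1\\ \chi_9&5&1&1&-3&-1&0&1&-1&0&-1&2\\ \chi_{10}&5&-1&-1&3&1&0&1&-1&0&-1&2\\ \chi_{11}&16&0&0&0&0&0&0&-2&1&0&-2 \end{array}$$ *)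

(* Defs.v *)
From mathcomp Require Import all_boot all_order all_algebra all_fingroup.
From mathcomp Require Import mxrepresentation character complex reals.

Set Implicit Arguments.
Unset Strict Implicit.
Unset Printing Implicit Defensive.

Import GRing.Theory.

Local Open Scope ring_scope.

Definition S6 : {group 'S_6} := [set: 'S_6]%G.

(* Fixed points count as cycles of length 1, so this is a partition of 6,
   listed in decreasing order. *)
Definition cycle_type (s : 'S_6) : seq nat :=
  sort geq [seq #|c| | c : {set 'I_6} <- enum (porbits s)].

Definition class_cycle_types : seq (seq nat) :=
  [:: [:: 1; 1; 1; 1; 1; 1]; [:: 2; 1; 1; 1; 1]; [:: 3; 2; 1]; [:: 2; 2; 2];
      [:: 4; 1; 1]; [:: 6]; [:: 2; 2; 1; 1]; [:: 3; 1; 1; 1]; [:: 5; 1];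
      [:: 4; 2]; [:: 3; 3]]%N.

Definition S6_table : seq (seq int) :=
  [:: [::  1;  1;  1;  1;  1;  1;  1;  1;  1;  1;  1];
      [::  1; -1; -1; -1; -1; -1;  1;  1;  1;  1;  1];
      [::  5;  3;  0; -1;  1; -1;  1;  2;  0; -1; -1];
      [::  5; -3;  0;  1; -1;  1;  1;  2;  0; -1; -1];
      [::  9;  3;  0;  3; -1;  0;  1;  0; -1;  1;  0];
      [::  9; -3;  0; -3;  1;  0;  1;  0; -1;  1;  0];
      [:: 10;  2; -1; -2;  0;  1; -2;  1;  0;  0;  1];
      [:: 10; -2;  1;  2;  0; -1; -2;  1;  0;  0;  1];
      [::  5;  1;  1; -3; -1;  0;  1; -1;  0; -1;  2];
      [::  5; -1; -1;  3;  1;  0;  1; -1;  0; -1;  2];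
      [:: 16;  0;  0;  0;  0;  0;  0; -2;  1;  0; -2]].

(* Rows and columns are numbered from 1; only 1 <= i, j <= 11 is meaningful. *)
Definition S6_chi (i j : nat) : int := nth 0 (nth [::] S6_table i.-1) j.-1.

Definition class_type (j : nat) : seq nat := nth [::] class_cycle_types j.-1.

Definition S6_repr (R : realType) : Type := representation R[i] S6.

Definition is_irrep (R : realType) (i : nat) (V : S6_repr R) : Prop :=
  mx_irreducible V /\
  forall (j : nat) (s : 'S_6), (1 <= j <= 11)%N ->
    cycle_type s = class_type j -> \tr (V s) = (S6_chi i j)%:~R.

Definition tensor (R : realType) (V W : S6_repr R) : S6_repr R :=
  Representation (prod_repr V W).

Definition dsum (R : realType) (V W : S6_repr R) : S6_repr R := dadd_grepr V W.

Definition multiple (R : realType) (m : nat) (V : S6_repr R) : S6_repr R :=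
  muln_grepr V m.

Definition isom (R : realType) (V W : S6_repr R) : Prop := mx_rsim V W.

Declare Scope rep_scope.
Delimit Scope rep_scope with rep.
Notation "V ⊗ W" := (tensor V W) (at level 40, left associativity) : rep_scope.
Notation "V ⊕ W" := (dsum V W) (at level 50, left associativity) : rep_scope.
Notation "V ≅ W" := (isom V W) (at level 70, W at next level) : rep_scope.
Notation "U ≅ V ≅ W" := (isom U V /\ isom V W)
  (at level 70, V at next level, W at next level) : rep_scope.

(* Main.v *)
Require Import Defs.
From mathcomp Require Import all_boot all_order all_algebra all_fingroup.
From mathcomp Require Import mxrepresentation character complex reals.
From mathcomp Require Import pgroup.

(** Both sides of each isomorphism have the same character, and over a field
    of characteristic 0 a representation of a finite group is determined by
    its character.

    For the second point ([rsim_eq_mxtrace]), let [e_i] be the central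
    idempotents of the group algebra given by the Wedderburn decomposition.
    The trace of [e_i] on a representation is a linear combination of
    character values, and, [e_i] acting as an idempotent, it is also the
    dimension of the image of [e_i] ([mxtrace_idempotent]).  So two
    representations with the same character are moved by the same [e_i].
    Since the [e_i] sum to 1, some [e_i] acts as a nonzero operator on both
    (unless both are zero); both then have the [i]-th irreducible
    representation as a direct summand ([irr_summand]), the complements again
    have equal characters, and one concludes by induction on the dimension.

    For the first point, characters turn tensor products into products and
    direct sums into sums, so that the characters of both sides are computed
    from the integer table.  Comparing its eleven columns is enough because
    the eleven cycle types are all the partitions of 6 ([cycle_type_class]).
    The isomorphism between a tensor product and its swap is obtained in the
    same way, multiplication of characters being commutative. *)

Set Implicit Arguments.
Unset Strict Implicit.
Unset Printing Implicit Defensive.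

Local Open Scope rep_scope.

(** * Characters determine representations in characteristic 0 *)

Section CharactersDetermine.

Import GRing.Theory.
Local Open Scope ring_scope.

(** A full rank factorization [E = C *m D] of an idempotent satisfies
    [D *m C = 1], and the trace is invariant under swapping factors. *)
Lemma mxtrace_idempotent (F : fieldType) n (E : 'M[F]_n) :
  E *m E = E -> \tr E = (\rank E)%:R.
Proof.
move=> idE.
have tr_fact r (C : 'M_(n, r)) (D : 'M_(r, n)) :
    row_full C -> row_free D -> C *m D = E -> \tr E = r%:R.
  move=> /row_fullP[L LC] /row_freeP[D' DD'] defE.
  suff DC : D *m C = 1%:M by rewrite -defE mxtrace_mulC DC mxtrace1.
  have := congr1 (fun X => L *m X *m D') idE.
  by rewrite -defE !mulmxA LC !mul1mx -!(mulmxA _ _ D') DD' !mulmx1.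
exact: tr_fact (col_base_full E) (row_base_free E) (mulmx_base E).
Qed.

Lemma natr_inj_pchar0 (F : idomainType) :
  [pchar F] =i pred0 -> injective (fun n => n%:R : F).
Proof.
move=> char0; have natr0 := (pcharf0P F).1 char0; move=> m n /= eq_mn.
wlog le_mn : m n eq_mn / (m <= n)%N.
  by move=> H; case/orP: (leq_total m n) => ?; [|symmetry]; apply: H.
apply/eqP; rewrite eqn_leq le_mn -subn_eq0 -natr0 natrB //.
by rewrite eq_mn subrr eqxx.
Qed.

Variables (F : decFieldType) (gT : finGroupType) (G : {group gT}).
Hypothesis char0 : [pchar F] =i pred0.

Local Notation reprG := (mx_representation F G).
Local Notation aG := (regular_repr F G).
Local Notation R_G := (enveloping_algebra_mx aG).

Let F'G : ([pchar F]^'.-group G)%g.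
Proof. by rewrite /pgroup pcharf'_nat ((pcharf0P F).1 char0) -lt0n. Qed.

Lemma gring_op_sum n (rG : reprG n) A :
  gring_op rG A = \sum_(i < #|G|) gring_row A 0 i *: rG (enum_val i).
Proof.
rewrite gring_opE /gring_mx /= mulmx_sum_row linear_sum /=.
by apply: eq_bigr => i _; rewrite linearZ /= rowK mxvecK.
Qed.

Lemma mxtrace_gring_op n1 n2 (rG1 : reprG n1) (rG2 : reprG n2) A :
    {in G, forall x, \tr (rG1 x) = \tr (rG2 x)} ->
  \tr (gring_op rG1 A) = \tr (gring_op rG2 A).
Proof.
move=> eq_tr; rewrite !gring_op_sum !linear_sum /=.
by apply: eq_bigr => i _; rewrite !linearZ /= eq_tr ?enum_valP.
Qed.

Lemma hom_gring_op n1 n2 (rG1 : reprG n1) (rG2 : reprG n2) B A :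
    {in G, forall x, rG1 x *m B = B *m rG2 x} ->
  gring_op rG1 A *m B = B *m gring_op rG2 A.
Proof.
move=> homB; rewrite !gring_op_sum mulmx_suml mulmx_sumr.
by apply: eq_bigr => i _; rewrite -scalemxAl -scalemxAr homB ?enum_valP.
Qed.

Let Wedderburn_id_gring (sG : irrType F G) (i : sG) :
  (Wedderburn_id i \in R_G)%MS.
Proof.
by rewrite -(Wedderburn_sum_pchar sG F'G) (sumsmx_sup i) ?Wedderburn_id_mem.
Qed.

Lemma gring_op_Wedderburn_idem (sG : irrType F G) n (rG : reprG n) (i : sG) :
  let E := gring_op rG (Wedderburn_id i) in E *m E = E.
Proof.
have [_ e_mem idl _] := Wedderburn_is_id_pchar F'G i.
by rewrite /= -gring_opM ?Wedderburn_id_gring ?idl.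
Qed.

(** Writing [e] for the idempotent and [x] for a group element, [e x] lies in
    the two-sided ideal with unit [e], hence [e x = (e x) e]: acting by [x] on
    the image of [e] does not leave that image. *)
Lemma gring_op_Wedderburn_module (sG : irrType F G) n (rG : reprG n) (i : sG) :
  mxmodule rG (gring_op rG (Wedderburn_id i)).
Proof.
apply/mxmoduleP => x Gx; have [_ e_mem _ idr] := Wedderburn_is_id_pchar F'G i.
have ex_mem : (Wedderburn_id i *m aG x \in Wedderburn_subring i)%MS.
  have [_ idrR] := andP (Wedderburn_ideal i).
  by apply: (memmx_subP idrR); rewrite mem_mulsmx ?envelop_mx_id.
rewrite -(gring_opG rG Gx) -gring_opM ?envelop_mx_id //.
by rewrite -(idr _ ex_mem) (gring_opM rG _ (Wedderburn_id_gring i)) submxMl.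
Qed.

(** Take [U] simple in the image of [e_i].  The idempotent [e_i] acts on [U] as
    the identity, whereas it acts as 0 on the simple modules of any type other
    than [i]; so [U] has type [i], and Maschke's theorem splits it off. *)
Lemma irr_summand (sG : irrType F G) n (rG : reprG n) (i : sG) :
    gring_op rG (Wedderburn_id i) != 0 ->
  exists (U V : 'M_n) (modU : mxmodule rG U) (modV : mxmodule rG V),
    [/\ mx_rsim (submod_repr modU) (irr_repr i),
        (U + V :=: 1%:M)%MS & mxdirect (U + V)].
Proof.
set E := gring_op _ _ => nzE.
have [U simU sUE] :=
  dec_mxsimple_exists (gring_op_Wedderburn_module rG i) nzE.
have [modU nzU _] := simU.
have [V modV defV dxV] := mx_Maschke_pchar rG F'G modU (submx1 U).
exists U, V, modU, modV; split=> //.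
have irrU : mx_irreducible (submod_repr modU) by apply/submod_mx_irr.
suff -> : i = irr_comp sG (submod_repr modU) by apply: rsim_irr_comp_pchar.
apply/eqP; apply: contraNT nzU => ne_i.
(* B is the inclusion of U; it intertwines the two actions of e_i. *)
pose B : 'M_(\rank U, n) := val_submod 1%:M.
have homB : {in G, forall x, submod_repr modU x *m B = B *m rG x}.
  by move=> x Gx; rewrite -val_submodJ // mul1mx -val_submodE.
have := hom_gring_op (Wedderburn_id i) homB.
rewrite (irr_comp'_op0_pchar F'G irrU ne_i (Wedderburn_id_mem i)) mul0mx -/E.
have /submxP[D defB] : (B <= E)%MS by rewrite val_submod1.
rewrite defB -mulmxA gring_op_Wedderburn_idem -defB => B0.
have := val_submod1 U; rewrite -/B -B0 => eqU0.
by rewrite -submx0 -eqU0 sub0mx.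
Qed.

(** Induction on the dimension, splitting off the same irreducible summand
    from both representations. *)
Theorem rsim_eq_mxtrace (rG1 rG2 : representation F G) :
    {in G, forall x, \tr (rG1 x) = \tr (rG2 x)} -> mx_rsim rG1 rG2.
Proof.
pose sG : irrType F G := DecSocleType aG.
have [m] := ubnP (rdegree rG1); elim: m rG1 rG2 => // m IHm.
case=> n1 rG1 [n2 rG2] /= ltn1 eq_tr.
(* The trace at 1 is the degree. *)
have eqn : n1 = n2.
  have := eq_tr _ (group1 G); rewrite !repr_mx1 !mxtrace1.
  exact: (natr_inj_pchar0 char0).
case: n2 / eqn rG2 eq_tr => rG2 eq_tr.
have [n0 | n_gt0] := posnP n1.
  exists 1%:M => [||x Gx]; rewrite ?row_free_unit ?unitmx1 //.
  by apply/matrixP=> k; have := ltn_ord k; rewrite {2}n0.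
have [i nzE1 | E0] :=
    pickP (fun i : sG => gring_op rG1 (Wedderburn_id i) != 0); last first.
  have := gring_op1 rG1; rewrite -(Wedderburn_sum_id_pchar sG F'G) linear_sum.
  rewrite big1 => [/esym/eqP|i _]; last by move/negbFE/eqP: (E0 i).
  by rewrite -mxrank_eq0 mxrank1 eqn0Ngt n_gt0.
have nzE2 : gring_op rG2 (Wedderburn_id i) != 0.
  move: nzE1; rewrite -!mxrank_eq0; congr (_ != _).
  apply: (natr_inj_pchar0 char0).
  rewrite -!mxtrace_idempotent ?gring_op_Wedderburn_idem //.
  by rewrite (mxtrace_gring_op _ eq_tr).
have [U1 [V1 [modU1 [modV1 [simU1 def1 dx1]]]]] := irr_summand nzE1.
have [U2 [V2 [modU2 [modV2 [simU2 def2 dx2]]]]] := irr_summand nzE2.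
pose rU := Representation (irr_repr i).
pose rV := Representation (submod_repr modV2).
have simV : mx_rsim (submod_repr modV1) rV.
  apply: (IHm (Representation (submod_repr modV1)) rV) => /= [|x Gx].
    have := mxrank1 F n1; rewrite -def1 (mxdirectP dx1) /= => rankUV.
    apply: leq_trans (_ : (n1 <= m)%N) => //.
    suff : (0 < \rank U1)%N.
      by rewrite -[X in _ -> (_ < X)%N]rankUV -[X in _ -> (X < _)%N]add0n
        ltn_add2r.
    by rewrite (mxrank_rsim simU1) irr_degree_gt0.
  apply: (addrI (\tr (submod_repr modU1 x))).
  rewrite {2}(mxtrace_rsim (mx_rsim_trans simU1 (mx_rsim_sym simU2))) //.
  rewrite (mxtrace_dadd_mod modU1 modV1 (mxmodule1 rG1) def1 dx1) //.
  rewrite (mxtrace_dadd_mod modU2 modV2 (mxmodule1 rG2) def2 dx2) //.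
  by rewrite !mxtrace_submod1 // eq_tr.
have full1 : mx_rsim (submod_repr (mxmodule1 rG1)) rG1 by apply: rsim_submod1.
have full2 : mx_rsim (submod_repr (mxmodule1 rG2)) rG2 by apply: rsim_submod1.
apply: mx_rsim_trans (mx_rsim_sym full1) _; apply: mx_rsim_trans full2.
apply: (mx_rsim_trans (rG2 := dadd_grepr rU rV)).
  exact: (mx_rsim_dadd (rU := rU) (rV := rV) _ def1 dx1 simU1 simV).
apply: mx_rsim_sym.
exact: (mx_rsim_dadd (rU := rU) (rV := rV) _ def2 dx2 simU2 (mx_rsim_refl _)).
Qed.

End CharactersDetermine.

(** * Cycle types of permutations of six points *)

(** Partitions, enumerated by choosing the largest part first; [bound] keeps
    the parts decreasing, and [fuel], which makes the recursion structural,
    amounts to a bound on the number of parts. *)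
Fixpoint partitions_upto (fuel bound n : nat) : seq (seq nat) :=
  if n is 0 then [:: [::]] else
  if fuel is k.+1 then
    flatten [seq map (cons a) (partitions_upto k a (n - a))
            | a <- iota 1 (minn bound n)]
  else [::].

Lemma mem_partitions_upto fuel bound (l : seq nat) :
    (size l <= fuel)%N -> path geq bound l -> all (leq 1) l ->
  l \in partitions_upto fuel bound (sumn l).
Proof.
elim: l fuel bound => [|a l IHl] [|k] bound //=.
move=> size_l /andP[le_a path_l] /andP[a_gt0 l_gt0].
case def_n: (a + sumn l) => [|n]; first by move: a_gt0; case: (a) def_n.
apply/flatten_mapP; exists a.
  by rewrite mem_iota a_gt0 add1n ltnS leq_min le_a -def_n leq_addr.
by apply: map_f; rewrite -def_n addKn; apply: IHl.
Qed.

Lemma size_le_sumn (l : seq nat) : all (leq 1) l -> (size l <= sumn l)%N.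
Proof.
by elim: l => //= a l IHl /andP[a_gt0 /IHl]; rewrite -add1n; apply: leq_add.
Qed.

Lemma sum_card_porbits (T : finType) (s : {perm T}) :
  \sum_(A in porbits s) #|A| = #|T|.
Proof.
have actT : [acts <[s]>%g, on [set: T] | 'P]%act.
  by apply/actsP => x _ y; rewrite !inE.
have <- : orbit 'P <[s]>%g @: [set: T] = porbits s.
  apply/setP => A.
  by apply/imsetP/imsetP => -[x _ ->]; exists x; rewrite ?porbitE.
by rewrite -(card_partition (orbit_partition actT)) cardsT.
Qed.

Lemma sumn_cycle_type s : sumn (cycle_type s) = 6.
Proof.
rewrite /cycle_type (perm_sumn (permEl (perm_sort _ _))) sumnE big_map.
by rewrite big_enum /= sum_card_porbits card_ord.
Qed.

Lemma cycle_type_class s :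
  exists2 j : nat, (1 <= j <= 11)%N & cycle_type s = class_type j.
Proof.
have pos : all (leq 1) (cycle_type s).
  rewrite all_sort; apply/allP => _ /mapP[c c_in ->].
  move: c_in; rewrite mem_enum => /imsetP[x _ ->].
  by apply/card_gt0P; exists x; apply: porbit_id.
have sum6 := sumn_cycle_type s.
have size6 := size_le_sumn pos; rewrite sum6 in size6.
have le6 : path geq 6 (cycle_type s).
  have := sort_sorted (fun x y => leq_total y x)
            [seq #|c| | c : {set 'I_6} <- enum (porbits s)].
  rewrite -/(cycle_type s).
  by case: (cycle_type s) sum6 => //= a l <- ->; rewrite andbT; apply: leq_addr.
have := mem_partitions_upto size6 le6 pos; rewrite sum6 => in6.
have /allP/(_ _ in6) :
    all (fun l => l \in class_cycle_types) (partitions_upto 6 6 6).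
  by vm_compute.
by move=> /(nthP [::])[j lt_j <-]; exists j.+1.
Qed.

(** * Computing with integral characters of S6 *)

Section IntegralCharacters.

Import GRing.Theory Num.Theory.
Local Open Scope ring_scope.

Variable R : realType.
Implicit Types V W : S6_repr R.

Definition has_char V (f : nat -> int) : Prop :=
  forall (j : nat) (s : 'S_6), (1 <= j <= 11)%N ->
    cycle_type s = class_type j -> \tr (V s) = (f j)%:~R.

Lemma has_char_irrep i V : is_irrep i V -> has_char V (S6_chi i).
Proof. by case. Qed.

Lemma has_char_tensor V W f g :
  has_char V f -> has_char W g -> has_char (V ⊗ W) (fun j => f j * g j).
Proof.
move=> Vf Wg j s j_in sj; rewrite /= mxtrace_prod intrM.
by rewrite (Vf j) // (Wg j).
Qed.

Lemma has_char_dsum V W f g :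
  has_char V f -> has_char W g -> has_char (V ⊕ W) (fun j => f j + g j).
Proof.
move=> Vf Wg j s j_in sj; rewrite /= mxtrace_block intrD.
by rewrite (Vf j) // (Wg j).
Qed.

Lemma has_char_multiple m V f :
  has_char V f -> has_char (multiple m V) (fun j => f j *+ m).
Proof.
move=> Vf j s j_in sj; rewrite /multiple /muln_grepr.
elim: m => [|m IHm]; first by rewrite big_ord0 /= mxtrace1.
by rewrite big_ord_recl /= mxtrace_block IHm (Vf j) // -intrD mulrS.
Qed.

Lemma isom_has_char V W f g :
    has_char V f -> has_char W g -> all (fun j => f j == g j) (iota 1 11) ->
  V ≅ W.
Proof.
move=> Vf Wg /allP eq_fg; apply: (rsim_eq_mxtrace (pchar_num _)) => s _.
have [j j_in sj] := cycle_type_class s.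
by rewrite (Vf j) // (Wg j) // (eqP (eq_fg j _)) // mem_iota.
Qed.

End IntegralCharacters.

(** * The decompositions *)

Ltac read_character irrep :=
  repeat first [ apply: has_char_tensor | apply: has_char_dsum
    | apply: has_char_multiple | apply: has_char_irrep; exact: irrep ].

(** The two characters are existential variables, instantiated by following
    the syntax of both sides; the equality of their eleven values then becomes
    a closed computation in [int]. *)
Ltac by_characters irrep :=
  eapply isom_has_char;
  [ read_character irrep | read_character irrep | vm_compute; reflexivity ].

Ltac each_index tac :=
  rewrite /= !inE; repeat (case/predU1P => [-> | ]; [by tac | ]);
  move/eqP->; by tac.

Theorem theorem6 (R : realType) (V : nat -> S6_repr R)
    (V_irrep : forall i : nat, (1 <= i <= 11)%N -> is_irrep i (V i)) :
  (forall j : nat, (1 <= j <= 11)%N -> V 1 ⊗ V j ≅ V j ⊗ V 1 ≅ V j) /\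
  (forall i : nat, i \in [:: 2; 4; 6; 8; 10]%N ->
    V 2 ⊗ V i ≅ V i ⊗ V 2 ≅ V i.-1) /\
  (forall i : nat, i \in [:: 3; 5; 7; 9]%N ->
    V 2 ⊗ V i ≅ V i ⊗ V 2 ≅ V i.+1) /\
  (V 2 ⊗ V 11 ≅ V 11 ⊗ V 2 ≅ V 11) /\
  (V 3 ⊗ V 3 ≅ V 1 ⊕ V 3 ⊕ V 5 ⊕ V 7) /\
  (V 3 ⊗ V 4 ≅ V 4 ⊗ V 3 ≅ V 2 ⊕ V 4 ⊕ V 6 ⊕ V 8) /\
  (V 3 ⊗ V 5 ≅ V 5 ⊗ V 3 ≅ V 3 ⊕ V 5 ⊕ V 7 ⊕ V 9 ⊕ V 11) /\
  (V 3 ⊗ V 6 ≅ V 6 ⊗ V 3 ≅ V 4 ⊕ V 6 ⊕ V 8 ⊕ V 10 ⊕ V 11) /\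
  (V 3 ⊗ V 7 ≅ V 7 ⊗ V 3 ≅ V 3 ⊕ V 5 ⊕ V 7 ⊕ V 8 ⊕ V 11) /\
  (V 3 ⊗ V 8 ≅ V 8 ⊗ V 3 ≅ V 4 ⊕ V 6 ⊕ V 7 ⊕ V 8 ⊕ V 11) /\
  (V 3 ⊗ V 9 ≅ V 9 ⊗ V 3 ≅ V 5 ⊕ V 11) /\
  (V 3 ⊗ V 10 ≅ V 10 ⊗ V 3 ≅ V 6 ⊕ V 11) /\
  (V 3 ⊗ V 11 ≅ V 11 ⊗ V 3 ≅
    V 5 ⊕ V 6 ⊕ V 7 ⊕ V 8 ⊕ V 9 ⊕ V 10 ⊕ multiple 2 (V 11)).
Proof.
split=> [j j_in|].
  have {j_in}: j \in iota 1 11 by rewrite mem_iota.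
  by each_index ltac:(split; by_characters V_irrep).
split=> [i|]; first by each_index ltac:(split; by_characters V_irrep).
split=> [i|]; first by each_index ltac:(split; by_characters V_irrep).
by repeat match goal with |- _ /\ _ => split end; by_characters V_irrep.
Qed.
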